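(* The expected time until absorption $m_i$ when starting in $i$ ($i=0,1,2,\dots$) in a $[pqrs]$ random walk on $[0,\infty)$, with absorbing barrier $0$, is $$m_i=\frac1s\left(1-\xi_1^{-i}\right).$$
   Context: Let $p,q,s>0$, $r\ge0$ with $p+q+r+s=1$. A $[pqrs]$ random walk on an interval of integers: in each state $n$ that is not an absorbing barrier, at each time unit the walk moves to $n+1$ with probability $p$, moves to $n-1$ with probability $q$, stays in $n$ for a time unit with probability $r$, and with probability $s$ is absorbed in the current state $n$ (the process terminates there). When the walk reaches an absorbing barrier it is absorbed there. Each action (step, stay, or absorption in the current non-barrier state) takes one time unit; the time until absorption is the number of time units until the process terminates, and is $0$ when starting in a barrier. Notation: $$\xi_1=\frac{(1-r)+\sqrt{(1-r)^2-4pq}}{2q}.$$ *)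

(* Defs.v *)
(* MathComp-Analysis *)
From HB Require Import structures.
From mathcomp Require Import all_boot all_order all_algebra.
From mathcomp Require Import all_classical all_reals all_analysis.

Set Implicit Arguments.
Unset Strict Implicit.
Unset Printing Implicit Defensive.

Import Order.TTheory GRing.Theory Num.Theory.
Local Open Scope classical_set_scope.
Local Open Scope ring_scope.

(* A state (n, b) records the position n in [0, oo) and whether the walk has
   already been absorbed in the non-barrier position n by an s-transition
   (b = true).  The position 0 is the absorbing barrier, whatever b is. *)
Definition state : Type := (nat * bool)%type.

Definition absorbed (x : state) : bool := (x.1 == 0%N) || x.2.

(* One-step transition probability from x to y in one time unit.  In the last
   case x.1 > 0, so x.1.-1 is the true predecessor and the four targets are
   pairwise distinct. *)
Definition transition {R : realType} (p q r s : R) (x y : state) : R :=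
  if absorbed x then (y == x)%:R
  else if y == (x.1.+1, false) then p
  else if y == (x.1.-1, false) then q
  else if y == (x.1, false) then r
  else if y == (x.1, true) then s
  else 0.

Section Walk.
Context {d : measure_display} {Omega : measurableType d} {R : realType}.
Variable P : probability Omega R.

Definition path_event (X : nat -> {RV P >-> state}) (x : nat -> state)
    (n : nat) : set Omega :=
  [set w | forall k : nat, (k <= n)%N -> X k w = x k].

(* X is a Markov chain started in position i with the transition probabilities
   above; the Markov property is written in product form in order to avoid
   conditioning on null events. *)
Definition pqrs_walk (p q r s : R) (i : nat) (X : nat -> {RV P >-> state}) :
    Prop :=
  P (X 0%N @^-1` [set (i, false)]) = 1%E /\
  forall (x : nat -> state) (n : nat),
    P (path_event X x n.+1) =
    (P (path_event X x n) * (transition p q r s (x n) (x n.+1))%:E)%E.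

(* The value is +oo on the outcomes where the walk is never absorbed. *)
Definition absorption_time (X : nat -> {RV P >-> state}) (w : Omega) : \bar R :=
  ereal_inf [set (n%:R : R)%:E | n in [set n : nat | absorbed (X n w)]].

Definition expected_absorption_time (X : nat -> {RV P >-> state}) : \bar R :=
  (\int[P]_w absorption_time X w)%E.

End Walk.

Definition xi1 {R : realType} (p q r : R) : R :=
  ((1 - r) + Num.sqrt ((1 - r) ^+ 2 - 4 * p * q)) / (2 * q).

(* Main.v *)
Require Import Defs.
From HB Require Import structures.
From mathcomp Require Import all_boot all_order all_algebra.
From mathcomp Require Import all_classical all_reals all_analysis.
From mathcomp Require Import measurable_realfun zify ring lra.

Set Implicit Arguments.
Unset Strict Implicit.
Unset Printing Implicit Defensive.

Import Order.TTheory GRing.Theory Num.Theory.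
Import numFieldNormedType.Exports.
Local Open Scope classical_set_scope.
Local Open Scope ring_scope.

(** Put z = 1/xi1, the root in (0, 1) of p z^2 - (1 - r) z + q = 0, and let
    h(n) = (1 - z^n)/s in an unabsorbed position n, h = 0 in an absorbed state.
    The equation for z makes h drop by exactly 1 on average at each step from
    an unabsorbed state ([next_mean_potential]): h is the candidate for the
    expected remaining lifetime.

    Let S_n be the event that the walk is not absorbed at any time k <= n.
    The absorption time is the sum of the indicators of the S_n, so its mean is
    the sum of the P(S_n) ([expected_absorption_time_alive]).  Let
    u_n = E[h(X_n); S_n].  Since h vanishes on absorbed states, the Markov
    property ([markov_cylinder]) and the drop of h give
    u_n = u_(n+1) + P(S_n) ([mean_potentialS]), so the partial sums of the
    P(S_n) are u_0 - u_n.  They are bounded by u_0, hence P(S_n) tends to 0;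
    as h <= 1/s, so does u_n ([sum_of_decrements]).  Therefore the mean is
    u_0 = h(i).

    The Markov property of the walk is given for single paths only, whereas S_n
    constrains each X_k to a set.  The passage from paths to such cylinders
    replaces one coordinate at a time by a set, decomposing over the countably
    many values of this coordinate ([eq_integral_fibers]). *)

(** * Random variables with countably many values *)

Section CountableValued.
Context {d : measure_display} {Omega : measurableType d} {R : realType}.
Context {T : countType}.
Variables (P : probability Omega R) (Y : Omega -> T).
Hypothesis mY : forall c, measurable [set w | Y w = c].

Lemma measurable_preimage_countable (B : set T) : measurable (Y @^-1` B).
Proof.
rewrite (_ : _ @^-1` _ = \bigcup_c ([set w | Y w = c] `&` [set _ | B c])).
  apply: countable_bigcupT_measurable => [|c]; first exact: countableP.
  apply: measurableI; first exact: mY.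
  have [Bc|nBc] := pselect (B c).
    by rewrite (_ : [set _ | _] = setT)//; apply/seteqP; split.
  by rewrite (_ : [set _ | _] = set0)//; apply/seteqP; split.
apply/seteqP; split => [w Bw|w [c _ [/= <-]]//].
by exists (Y w).
Qed.

Lemma measurable_fun_countable (g : T -> R) (D : set Omega) :
  measurable_fun D (fun w => (g (Y w))%:E).
Proof.
apply: measurable_funTS => _ B mB; rewrite setTI.
exact: (measurable_preimage_countable [set c | B (g c)%:E]).
Qed.

(** Countable additivity of the integral over the fibers of Y. *)
Lemma eq_integral_fibers (D : set Omega) (f g : Omega -> \bar R) :
  measurable D -> measurable_fun setT f -> measurable_fun setT g ->
  (forall w, 0 <= f w)%E -> (forall w, 0 <= g w)%E ->
  (forall c, \int[P]_(w in D `&` [set w | Y w = c]) f w =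
             \int[P]_(w in D `&` [set w | Y w = c]) g w)%E ->
  (\int[P]_(w in D) f w = \int[P]_(w in D) g w)%E.
Proof.
move=> mD mf mg f0 g0 fg.
(* The fibers are indexed by nat through the encoding of T; codes that are not
   attained contribute empty sets. *)
pose F n := D `&` [set w | pickle (Y w) = n].
have DF : D = \bigcup_n F n.
  by apply/seteqP; split => [w Dw|w [n _ []]//]; exists (pickle (Y w)).
have mF n : measurable (F n).
  apply: measurableI => //.
  exact: (measurable_preimage_countable [set c | pickle c = n]).
have tF : trivIset setT F.
  by move=> m n _ _ [w [[_ /= <-] [_ /= <-]]].
have intF h : measurable_fun setT h -> (forall w, 0 <= h w)%E ->
    (\int[P]_(w in D) h w = \sum_(n <oo) \int[P]_(w in F n) h w)%E.
  by move=> mh h0; rewrite {1}DF ge0_integral_bigcup//; exact: measurable_funTS.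
rewrite !intF//; apply: eq_eseriesr => n _.
have [[c cn]|nc] := pselect (exists c : T, pickle c = n).
  rewrite (_ : F n = D `&` [set w | Y w = c])//.
  rewrite /F; congr (_ `&` _); apply/seteqP; split => w /=; rewrite -cn.
    exact: (pcan_inj pickleK).
  by move=> ->.
rewrite (_ : F n = set0) ?integral_set0//.
by apply/seteqP; split => // w [_ /= Yn]; apply: nc; exists (Y w).
Qed.

(** The hypothesis on the sum says that, within D, the variable Y takes its
    values in ys almost surely, so the rest of D is negligible. *)
Lemma integral_finitely_valued (D : set Omega) (g : T -> R) (ys : seq T) :
  measurable D -> uniq ys -> (forall c, 0 <= g c) ->
  (\sum_(y <- ys) P (D `&` [set w | Y w = y]) = P D)%E ->
  (\int[P]_(w in D) (g (Y w))%:E =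
   \sum_(y <- ys) (g y)%:E * P (D `&` [set w | Y w = y]))%E.
Proof.
move=> mD uys g0 sumD.
pose F y := D `&` [set w | Y w = y].
have mF y : measurable (F y) by apply: measurableI.
have tF : trivIset [set` ys] F.
  by move=> a b _ _ [w [[_ /= <-] [_ /= <-]]].
set U := \big[setU/set0]_(y <- ys) F y.
have mU : measurable U by apply: bigsetU_measurable.
have UD : U `<=` D by rewrite /U -bigcup_seq => w [y _ []].
have PU : P U = P D.
  rewrite -sumD /U -bigcup_seq measure_fin_bigcup//.
  by rewrite -fsbig_seq.
have PN : P (D `\` U) = 0.
  have Pfin : P D \is a fin_num by apply: fin_num_measure.
  have -> : P (D `\` U) = (P D - P (D `&` U))%E
    by rewrite measureD// ltey_eq Pfin.
  by rewrite setIidr// PU subee.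
rewrite -(setDUK UD) ge0_integral_setU//; last 4 first.
- exact: measurableD.
- exact: measurable_fun_countable.
- by move=> w _; rewrite lee_fin.
- by apply/disj_setPS => w [? []].
rewrite [X in (_ + X)%E]null_set_integral//; last 2 first.
- exact: measurableD.
- exact: measurable_fun_countable.
rewrite adde0 ge0_integral_bigsetU//; last 2 first.
- exact: measurable_fun_countable.
- by move=> w _; rewrite lee_fin.
apply: eq_bigr => y _; rewrite setDUK// -integral_cst; last exact: mF.
by apply: eq_integral => w /[!inE] -[_ /= ->].
Qed.

End CountableValued.

(** * The one-step mean *)

(** The case split matters at the barrier: in position 0 the four formulas
    would not give distinct states.  In each case the transition probabilities
    to these states add up to 1. *)
Definition targets (c : state) : seq state :=
  if absorbed c then [:: c]
  else [:: (c.1.+1, false); (c.1.-1, false); (c.1, false); (c.1, true)].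

Definition next_mean {R : realType} (p q r s : R) (g : state -> R)
    (c : state) : R :=
  \sum_(y <- targets c) transition p q r s c y * g y.

Lemma uniq_targets c : uniq (targets c).
Proof.
rewrite /targets; case: ifPn => // /norP[]; case: c => -[|n] b //= _ _.
by rewrite !inE !xpair_eqE !andbT !andbF/= eq_sym; lia.
Qed.

Lemma next_mean_active {R : realType} (p q r s : R) g n :
  next_mean p q r s g (n.+1, false) =
  p * g (n.+2, false) + q * g (n, false) + r * g (n.+1, false)
  + s * g (n.+1, true).
Proof.
rewrite /next_mean /targets/= !big_cons big_nil/= /transition/= !xpair_eqE.
have e1 : (n.+2 == n) = false by lia.
have e2 : (n.+2 == n.+1) = false by lia.
have e3 : (n == n.+2) = false by lia.
have e4 : (n == n.+1) = false by lia.
have e5 : (n.+1 == n.+2) = false by lia.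
have e6 : (n.+1 == n) = false by lia.
by rewrite !(e1, e2, e3, e4, e5, e6, eqxx)/= addr0 !addrA.
Qed.

Lemma sum_transition {R : realType} (p q r s : R) c : p + q + r + s = 1 ->
  \sum_(y <- targets c) transition p q r s c y = 1.
Proof.
move=> pqrs.
have [ac|] := boolP (absorbed c).
  by rewrite /targets ac big_seq1 /transition ac eqxx.
case: c => -[|n] [] // _; rewrite -pqrs.
have := next_mean_active p q r s (cst 1) n; rewrite /next_mean /= !mulr1 => <-.
by apply: eq_bigr => y _; rewrite mulr1.
Qed.

(** * The Markov property on cylinders *)

Section Walk.
Context {d : measure_display} {Omega : measurableType d} {R : realType}.
Variables (P : probability Omega R) (X : nat -> {RV P >-> state}).

Lemma measurable_position k c : measurable [set w | X k w = c].
Proof.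
have mc : measurable [set c : nat * bool].
  rewrite (_ : [set c] = [set c.1] `*` [set c.2]); first exact: measurableX.
  by apply/seteqP; split => [_ ->//|[a b] [/= -> ->]]; case: c.
by have := measurable_funPTI (X k) mc.
Qed.

Lemma measurable_position_in k (A : set state) :
  measurable [set w | A (X k w)].
Proof. exact: (measurable_preimage_countable (measurable_position k)). Qed.

Definition cylinder (A : nat -> set state) (n : nat) : set Omega :=
  [set w | forall k : nat, (k <= n)%N -> A k (X k w)].

Lemma measurable_cylinder A n : measurable (cylinder A n).
Proof.
rewrite (_ : cylinder A n =
  \bigcap_(k in [set k | (k <= n)%N]) [set w | A k (X k w)])//.
apply: bigcap_measurable => [|k _]; first by exists 0%N.
exact: measurable_position_in.
Qed.

Lemma cylinderS A n :
  cylinder A n.+1 = cylinder A n `&` [set w | A n.+1 (X n.+1 w)].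
Proof.
apply/seteqP; split => [w Aw|w [Aw An] k].
  by split => [k kn|]; apply: Aw => //; exact: leqW.
by rewrite leq_eqVlt => /predU1P[->//|]; exact: Aw.
Qed.

Variables (p q r s : R).
Hypotheses (p0 : 0 < p) (q0 : 0 < q) (r0 : 0 <= r) (s0 : 0 < s).
Hypothesis pqrs : p + q + r + s = 1.
Variable i : nat.
Hypothesis hX : pqrs_walk p q r s i X.

Lemma transition_ge0 x y : 0 <= transition p q r s x y.
Proof. by rewrite /transition; repeat case: ifP => _ //; apply: ltW. Qed.

Lemma next_mean_ge0 g c : (forall c, 0 <= g c) -> 0 <= next_mean p q r s g c.
Proof.
by move=> g0; apply: sumr_ge0 => y _; rewrite mulr_ge0// transition_ge0.
Qed.

(** One step beyond a fixed history; y need not be the (n+1)-st state of x. *)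
Lemma path_eventS x n y :
  P (path_event X x n `&` [set w | X n.+1 w = y]) =
  (P (path_event X x n) * (transition p q r s (x n) y)%:E)%E.
Proof.
pose x' k := if k == n.+1 then y else x k.
have x'x k : (k <= n)%N -> x' k = x k.
  by move=> kn; rewrite /x' ltn_eqF.
have E : path_event X x' n = path_event X x n.
  by apply/seteqP; split => w + k kn => /(_ k kn); rewrite x'x.
have := hX.2 x' n.
rewrite E x'x// {2}/x' eqxx => <-; congr (P _).
rewrite (cylinderS (fun k => [set x' k]) n : path_event X x' n.+1 = _).
by congr (_ `&` _) => //; rewrite /x' eqxx.
Qed.

(** Given the history up to time n, the next state lies almost surely in
    [targets (x n)], because the transition probabilities to these states add
    up to 1. *)
Lemma markov_path (g : state -> R) x n : (forall c, 0 <= g c) ->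
  (\int[P]_(w in path_event X x n) (g (X n.+1 w))%:E =
   \int[P]_(w in path_event X x n) (next_mean p q r s g (X n w))%:E)%E.
Proof.
move=> g0; set D := path_event X x n.
have mD : measurable D := measurable_cylinder (fun k => [set x k]) n.
rewrite (@integral_finitely_valued _ _ _ _ P (X n.+1) _ D g (targets (x n)))//.
- transitivity (\int[P]_(w in D) (cst (next_mean p q r s g (x n))%:E) w)%E.
    rewrite integral_cst// /next_mean -sumEFin ge0_sume_distrl.
      apply: eq_bigr => y _; rewrite path_eventS.
      by rewrite EFinM muleA muleAC; congr (_ * _)%E; exact: muleC.
    by move=> y _; rewrite lee_fin mulr_ge0// transition_ge0.
  by apply: eq_integral => w /[!inE] Dw /=; rewrite Dw.
- exact: measurable_position.
- exact: uniq_targets.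
under eq_bigr do rewrite path_eventS.
rewrite -ge0_sume_distrr; last by move=> y _; rewrite lee_fin transition_ge0.
by rewrite sumEFin sum_transition// mule1.
Qed.

(** E[g(X_(n+1)); C] = E[(K g)(X_n); C], with K the transition operator, for
    every cylinder C over the times 0, ..., n.  Induction on the number m of
    initial coordinates that may range over arbitrary sets, the later ones being
    prescribed: for m = 0 the cylinder is a path, and the fiber over X_m = c of
    a cylinder with m + 1 free coordinates has only m free ones. *)
Lemma markov_cylinder (g : state -> R) A n : (forall c, 0 <= g c) ->
  (\int[P]_(w in cylinder A n) (g (X n.+1 w))%:E =
   \int[P]_(w in cylinder A n) (next_mean p q r s g (X n w))%:E)%E.
Proof.
move=> g0.
suff H m : (m <= n.+1)%N -> forall B : nat -> set state,
    (forall k, (m <= k <= n)%N -> exists c, B k = [set c]) ->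
  (\int[P]_(w in cylinder B n) (g (X n.+1 w))%:E =
   \int[P]_(w in cylinder B n) (next_mean p q r s g (X n w))%:E)%E.
  by apply: (H n.+1) => // k; case: ltnP.
elim: m => [_ B sB|m IH mn B sB].
  have /choice[x xP] : forall k, exists c, (k <= n)%N -> B k = [set c].
    move=> k; have [kn|_] := leqP k n; last by exists (0%N, false).
    by have [c Bc] := sB k kn; exists c.
  have -> : cylinder B n = path_event X x n; last exact: markov_path.
  by apply/seteqP; split => w + k kn => /(_ k kn); rewrite xP.
apply: (@eq_integral_fibers _ _ _ _ P (X m)).
- exact: measurable_position.
- exact: measurable_cylinder.
- exact: measurable_fun_countable (measurable_position _) _ _.
- exact: measurable_fun_countable (measurable_position _) _ _.
- by move=> w; rewrite lee_fin.
- by move=> w; rewrite lee_fin next_mean_ge0.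
move=> c; have [Bc|nBc] := pselect (B m c); last first.
  rewrite (_ : _ `&` _ = set0) ?integral_set0//.
  by apply/seteqP; split => // w [/(_ m mn) + /= Xc]; rewrite Xc.
pose B' k := if k == m then [set c] else B k.
have -> : cylinder B n `&` [set w | X m w = c] = cylinder B' n.
  apply/seteqP; split => [w [Bw Xc] k kn|w Bw].
    by rewrite /B'; case: eqP => [->//|_]; exact: Bw.
  split => [k kn|/=]; have := Bw _ mn; rewrite {1}/B' eqxx /= => Xc //.
  have [->|km] := eqVneq k m; first by rewrite Xc.
  by have := Bw k kn; rewrite /B' (negbTE km).
apply: IH; first exact: ltnW.
move=> k /andP[mk kn]; rewrite /B'.
have [_|km] := eqVneq k m; first by exists c.
by apply: sB; rewrite kn andbT ltn_neqAle eq_sym km.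
Qed.

End Walk.

(** * The potential *)

(** At x = 1 the polynomial q x^2 - (1 - r) x + p equals -s < 0, so its roots
    are real and the larger one exceeds 1. *)
Lemma xi1_root {R : realType} (p q r s : R) : 0 < p -> 0 < q -> 0 < s ->
  p + q + r + s = 1 ->
  q * xi1 p q r ^+ 2 + p = (1 - r) * xi1 p q r /\ 1 < xi1 p q r.
Proof.
move=> p0 q0 s0 pqrs.
have D0 : 0 <= (1 - r) ^+ 2 - 4 * p * q.
  have -> : 1 - r = p + q + s by lra.
  have := sqr_ge0 (p - q); rewrite !expr2; nra.
have tE := sqr_sqrtr D0; have t0 := sqrtr_ge0 ((1 - r) ^+ 2 - 4 * p * q).
rewrite /xi1; move: (Num.sqrt _) tE t0 => t tE t0.
split.
  have -> : q * (((1 - r) + t) / (2 * q)) ^+ 2 =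
      ((1 - r) ^+ 2 + 2 * (1 - r) * t + t ^+ 2) / (4 * q).
    by field; rewrite gt_eqF.
  by rewrite tE; field; rewrite gt_eqF.
rewrite ltr_pdivlMr ?mulr_gt0// mul1r ltNge; apply/negP => le.
have r1 : r = 1 - p - q - s by lra.
move: tE le; rewrite r1 !expr2 => tE le.
have : t * t <= (q - p - s) * (q - p - s) by apply: ler_pM => //; lra.
have := mulr_gt0 q0 s0; nra.
Qed.

Definition potential {R : realType} (z s : R) (c : state) : R :=
  if absorbed c then 0 else s^-1 * (1 - z ^+ c.1).

(** From n+1 the walk lands in n+2, n, n+1 or is absorbed, and the mean of the
    new potential is ((1 - s) - z^n (p z^2 + q + r z))/s
    = (1 - z^(n+1))/s - 1, by the equation for z. *)
Lemma next_mean_potential {R : realType} (p q r s z : R) (c : state) :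
  s != 0 -> p + q + r + s = 1 -> p * z ^+ 2 + q = (1 - r) * z ->
  ~~ absorbed c ->
  next_mean p q r s (potential z s) c + 1 = potential z s c.
Proof.
move=> s0 pqrs zE; case: c => -[|n] [] // _; rewrite next_mean_active.
have -> : potential z s (n, false) = s^-1 * (1 - z ^+ n).
  by case: n => [|n]//; rewrite /potential/= expr0 subrr mulr0.
rewrite /potential/= mulr0 addr0.
have -> : z ^+ n.+2 = z ^+ 2 * z ^+ n by rewrite -exprD.
have -> : z ^+ n.+1 = z * z ^+ n by rewrite exprS.
move: (z ^+ n) => x.
apply: (mulfI s0).
have E y : s * (s^-1 * y) = y by rewrite mulrA divff// mul1r.
have F a y : s * (a * (s^-1 * y)) = a * y by rewrite mulrCA E.
rewrite [LHS]mulrDr mulr1 E !mulrDr !F.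
have : (p * z ^+ 2 + q) * x = (1 - r) * z * x by rewrite zE.
lra.
Qed.

Lemma potential_ge0 {R : realType} (z s : R) c :
  0 <= z <= 1 -> 0 < s -> 0 <= potential z s c.
Proof.
move=> /andP[z0 z1] s0; rewrite /potential; case: ifP => // _.
by rewrite mulr_ge0 ?invr_ge0 ?(ltW s0)// subr_ge0 exprn_ile1.
Qed.

Lemma potential_le {R : realType} (z s : R) c :
  0 <= z -> 0 < s -> potential z s c <= s^-1.
Proof.
move=> z0 s0; rewrite /potential; case: ifP => _; first by rewrite invr_ge0 ltW.
by rewrite ler_piMr ?invr_ge0 ?(ltW s0)// gerBl exprn_ge0.
Qed.

(** The bound u <= M a spares a separate decay estimate: the partial sums
    u 0 - u n of the nonnegative a are bounded by u 0, so a, and with it u,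
    tends to 0. *)
Lemma sum_of_decrements {R : realType} (a u : nat -> R) (M : R) :
  (forall n, 0 <= a n) -> (forall n, 0 <= u n <= M * a n) ->
  (forall n, u n = u n.+1 + a n) ->
  (\sum_(n <oo) (a n)%:E = (u 0%N)%:E)%E.
Proof.
move=> a0 uM uS.
have sE n : series a n = u 0%N - u n.
  elim: n => [|n IH]; first by rewrite /series/= big_geq// subrr.
  by rewrite seriesSr IH (uS n); ring.
have ca : cvgn (series a).
  apply: nondecreasing_is_cvgn.
    by apply/nondecreasing_seqP => n; rewrite seriesSr lerDl.
  exists (u 0%N) => _ [n _ <-]; rewrite sE gerBl.
  by have /andP[] := uM n.
have u_to0 : u @ \oo --> 0.
  apply: (@squeeze_cvgr _ _ _ _ (cst 0) (fun n => M * a n)).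
  - by apply: nearW => n; exact: uM.
  - exact: cvg_cst.
  - rewrite -(mulr0 M); apply: cvgMr; exact: cvg_series_cvg_0.
have s_to : series a @ \oo --> u 0%N.
  rewrite (_ : series a = fun n => u 0%N - u n); last exact/funext.
  by rewrite -[X in _ --> X]subr0; apply: cvgB => //; exact: cvg_cst.
apply: cvg_lim => //.
rewrite (_ : (fun n => _) = EFin \o series a).
  by apply: cvg_comp s_to _; exact: cvg_refl.
by apply/funext => n; rewrite /= -sumEFin.
Qed.

(** * Survival of the walk *)

Section Survival.
Context {d : measure_display} {Omega : measurableType d} {R : realType}.
Variables (P : probability Omega R) (X : nat -> {RV P >-> state}).

(** The walk is required to be unabsorbed at all times k <= n, and not only at
    time n: the absorption time is then the sum of the indicators of these
    events on every outcome, whereas that absorbed states are never left holds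
    only almost surely. *)
Definition alive (n : nat) : set Omega :=
  cylinder X (fun=> [set c | ~~ absorbed c]) n.

Lemma absorption_time_alive w :
  absorption_time X w = (\sum_(n <oo) (\1_(alive n) w : R)%:E)%E.
Proof.
have [|noabs] := pselect (exists n, absorbed (X n w)).
  move=> /ex_minnP[N absN minN].
  have aliveE n : (w \in alive n) = (n < N)%N.
    apply/idP/idP => [|nN].
      by rewrite inE ltnNge => aw; apply/negP => /aw/negP.
    rewrite inE => k kn; apply/negP => /minN; lia.
  rewrite (nneseries_split 0 N); last by move=> k _; rewrite lee_fin.
  rewrite add0n eseries0 ?adde0; last first.
    by move=> k Nk _; rewrite indicE aliveE ltnNge Nk.
  rewrite (_ : (\sum_(0 <= k < N) _)%E = (N%:R)%:E); last first.
    rewrite sumEFin (eq_big_nat _ _ (F2 := fun=> 1)).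
      by rewrite sumr_const_nat subn0.
    by move=> k /andP[_ kN]; rewrite indicE aliveE kN.
  apply/eqP; rewrite eq_le; apply/andP; split.
    by apply: ereal_inf_lbound; exists N.
  by apply: le_ereal_inf_tmp => _ [n /minN Nn <-]; rewrite lee_fin ler_nat.
rewrite /absorption_time (_ : [set n | _] = set0); last first.
  by apply/seteqP; split => // n /= an; apply: noabs; exists n.
rewrite image_set0 ereal_inf0; symmetry.
apply/eqyP => A A0.
(* All indicators equal 1, so the first N terms already exceed A. *)
pose N := (Num.trunc A).+1.
apply: le_trans (nneseries_lim_ge N _); last by move=> n _ _; rewrite lee_fin.
rewrite sumEFin (eq_big_nat _ _ (F2 := fun=> 1)).
  by rewrite sumr_const_nat subn0 lee_fin ltW// truncnS_gt.
move=> k _; rewrite indicE mem_set// => j _; apply/negP => aj.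
by apply: noabs; exists j.
Qed.

Lemma measurable_alive n : measurable (alive n).
Proof. exact: measurable_cylinder. Qed.

Lemma expected_absorption_time_alive :
  expected_absorption_time X = (\sum_(n <oo) P (alive n))%E.
Proof.
rewrite /expected_absorption_time.
under eq_integral do rewrite absorption_time_alive.
rewrite integral_nneseries//.
- apply: eq_eseriesr => n _; rewrite integral_indic// ?setIT//.
  exact: measurable_alive.
- move=> n; apply/measurable_EFinP; apply: measurable_indic.
  exact: measurable_alive.
Qed.

Variables (p q r s : R).
Hypotheses (p0 : 0 < p) (q0 : 0 < q) (r0 : 0 <= r) (s0 : 0 < s).
Hypothesis pqrs : p + q + r + s = 1.
Variable i : nat.
Hypothesis hX : pqrs_walk p q r s i X.
Variable z : R.
Hypotheses (z01 : 0 <= z <= 1) (zE : p * z ^+ 2 + q = (1 - r) * z).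

Let h := potential z s.
Let mh k (D : set Omega) : measurable_fun D (fun w => (h (X k w))%:E).
Proof. exact: measurable_fun_countable (measurable_position X k) _ _. Qed.
Let h0 c : 0 <= h c.
Proof. exact: potential_ge0. Qed.

Definition mean_potential n := (\int[P]_(w in alive n) (h (X n w))%:E)%E.

Lemma integral_potential_unabsorbed D n : measurable D ->
  (\int[P]_(w in D) (h (X n w))%:E =
   \int[P]_(w in D `&` [set w | ~~ absorbed (X n w)]) (h (X n w))%:E)%E.
Proof.
move=> mD; rewrite integral_mkcondr; apply: eq_integral => w _.
rewrite patchE; case: ifPn => //.
rewrite notin_setE/= => /negP; rewrite negbK => a.
by rewrite /h /potential a.
Qed.

Lemma mean_potential0 : mean_potential 0%N = (s^-1 * (1 - z ^+ i))%:E.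
Proof.
have -> : mean_potential 0%N = (\int[P]_(w in setT) (h (X 0%N w))%:E)%E.
  rewrite integral_potential_unabsorbed// setTI /mean_potential.
  congr (integral _ _ _).
  apply/seteqP; split => w; first by move/(_ 0%N); exact.
  by move=> aw k; rewrite leqn0 => /eqP ->.
rewrite (@integral_finitely_valued _ _ _ _ P (X 0%N) _ setT h
  [:: (i, false)])//.
- rewrite big_seq1 setTI hX.1 mule1 /h /potential.
  by case: (i) => [|n]//=; rewrite expr0 subrr mulr0.
- exact: measurable_position.
- by rewrite big_seq1 setTI probability_setT; exact: hX.1.
Qed.

(** The potential vanishes on absorbed states, so on [alive n] its mean at time
    n+1 is the same as on [alive n.+1]. *)
Lemma mean_potentialS n :
  (mean_potential n = mean_potential n.+1 + P (alive n))%E.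
Proof.
rewrite /mean_potential /alive cylinderS.
rewrite -integral_potential_unabsorbed; last exact: measurable_cylinder.
rewrite (markov_cylinder p0 q0 r0 s0 pqrs hX)//.
set D := cylinder _ _ _; have mD : measurable D := measurable_cylinder _ _ _.
rewrite -[P D]mul1e -integral_cst// -ge0_integralD//.
- apply: eq_integral => w /[!inE] Dw /=.
  rewrite -EFinD next_mean_potential// ?gt_eqF//; exact: Dw.
- by move=> w _; rewrite lee_fin next_mean_ge0.
- exact: measurable_fun_countable (measurable_position X n) _ _.
Qed.

Lemma mean_potential_le n : (mean_potential n <= s^-1%:E * P (alive n))%E.
Proof.
rewrite -integral_cst; last exact: measurable_alive.
apply: ge0_le_integral => //; first exact: measurable_alive.
- by move=> w _; rewrite lee_fin.
- by move=> w _; rewrite lee_fin potential_le//; case/andP: z01.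
Qed.

Lemma expected_absorption_time_walk :
  expected_absorption_time X = (s^-1 * (1 - z ^+ i))%:E.
Proof.
have Pfin n : P (alive n) \is a fin_num.
  by apply: fin_num_measure; exact: measurable_alive.
have u_ge0 n : (0 <= mean_potential n)%E.
  by apply: integral_ge0 => w _; rewrite lee_fin.
have ufin n : mean_potential n \is a fin_num.
  rewrite ge0_fin_numE// (le_lt_trans (mean_potential_le n))//.
  by rewrite -(fineK (Pfin n)) -EFinM ltry.
rewrite expected_absorption_time_alive -mean_potential0 -(fineK (ufin 0%N)).
under eq_eseriesr do rewrite -(fineK (Pfin _)).
apply: (@sum_of_decrements _ _ (fine \o mean_potential) s^-1) => n /=.
- by rewrite fine_ge0.
- by rewrite fine_ge0//= -lee_fin EFinM !fineK// mean_potential_le.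
- by rewrite mean_potentialS fineD.
Qed.

End Survival.

Theorem theorem11 (d : measure_display) (Omega : measurableType d)
    (R : realType) (P : probability Omega R)
    (p q r s : R) (hp : 0 < p) (hq : 0 < q) (hs : 0 < s) (hr : 0 <= r)
    (hsum : p + q + r + s = 1)
    (i : nat) (X : nat -> {RV P >-> state})
    (hX : pqrs_walk p q r s i X) :
  expected_absorption_time X = (s^-1 * (1 - xi1 p q r ^- i))%:E.
Proof.
have [xiE xi_gt1] := xi1_root hp hq hs hsum.
have xi_gt0 : 0 < xi1 p q r by apply: lt_trans xi_gt1.
rewrite -exprVn; apply: (expected_absorption_time_walk hp hq hr hs hsum hX).
  by rewrite invr_ge0 (ltW xi_gt0) invf_le1// ltW.
have xi_neq0 : xi1 p q r != 0 by rewrite gt_eqF.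
apply: (mulIf (expf_neq0 2 xi_neq0)).
rewrite mulrDl -mulrA -exprMn mulVf// expr1n mulr1 addrC xiE.
by field.
Qed.
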